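(* Let $X$ be a Banach space such that its unit sphere $S_X=\{x\in X:\|x\|=1\}$ is Lindelöf in the relative weak topology. Then $X$ has the countable separation property (CSP).
   Context: Banach spaces are real; $X^*$ is the dual of $X$. A set $\mathcal{F}\subset X^*$ separates $X$ if for every $x\in X\setminus\{0\}$ there is $f\in\mathcal{F}$ with $f(x)\neq 0$. $X$ has CSP if every separating set $\mathcal{F}\subset X^*$ contains a countable subset $\mathcal{F}_0\subset\mathcal{F}$ that separates $X$. *)

(* Defs.v *)
From HB Require Import structures.
From mathcomp Require Import all_boot all_order all_algebra.
From mathcomp Require Import all_classical all_reals all_analysis.

Set Implicit Arguments.
Unset Strict Implicit.
Unset Printing Implicit Defensive.

Import Order.TTheory GRing.Theory Num.Theory.
Import numFieldNormedType.Exports.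

Local Open Scope classical_set_scope.
Local Open Scope ring_scope.

Record dual (R : realType) (X : normedModType R) := Dual {
  dual_fun :> {scalar X};
  dual_continuous : continuous dual_fun
}.

Definition weak_space (R : realType) (X : normedModType R) : topologicalType :=
  sup_topology (fun f : dual X => Topological.on (initial_topology f)).

Definition unit_sphere (R : realType) (X : normedModType R) : set X :=
  [set x | `|x| = 1].
Arguments unit_sphere {R} X _.

(* No separation axiom (such as regularity) is included. *)
Definition lindelof (T : topologicalType) : Prop :=
  forall G : set (set T),
    (forall U, G U -> open U) -> \bigcup_(U in G) U = [set: T] ->
    exists G0 : set (set T),
      [/\ G0 `<=` G, countable G0 & \bigcup_(U in G0) U = [set: T]].

Definition separates (R : realType) (X : normedModType R) (F : set (dual X))
  : Prop :=
  forall x : X, x != 0 -> exists2 f, F f & f x != 0.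

(* [countable] includes the finite (and empty) families. *)
Definition CSP (R : realType) (X : normedModType R) : Prop :=
  forall F : set (dual X), separates F ->
    exists F0 : set (dual X), [/\ F0 `<=` F, countable F0 & separates F0].

(* Main.v *)
Require Import Defs.
From mathcomp Require Import all_boot all_order all_algebra.
From mathcomp Require Import all_classical all_reals all_analysis.

Import Order.TTheory GRing.Theory Num.Theory.
Import numFieldNormedType.Exports.

Local Open Scope classical_set_scope.
Local Open Scope ring_scope.

(** A functional f is nonzero at x as soon as it is nonzero at the unit vector
    on the ray through x. Hence a family F separates X exactly when the sets of
    unit vectors where f is nonzero, for f in F, cover the unit sphere
    ([separates_sphereP]). These sets are weakly open, because f is weakly
    continuous ([weak_continuous]), so a Lindelöf sphere is covered by countably
    many of them; choosing one functional for each member of the countable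
    subcover gives a countable separating subfamily. *)

Lemma separates_sphereP (R : realType) (X : normedModType R)
    (F : set (dual X)) :
  separates F <->
  forall s : X, unit_sphere X s -> exists2 f, F f & f s != 0.
Proof.
split=> [sepF s s1|sepF x x0].
  by apply: sepF; rewrite -normr_eq0 (s1 : `|s| = 1) oner_eq0.
have nx0 : `|x| != 0 by rewrite normr_eq0.
have [|f Ff] := sepF (`|x|^-1 *: x).
  by rewrite /unit_sphere /= normrZ normfV normr_id mulVf.
by rewrite linearZ /= mulf_eq0 invr_eq0 (negbTE nx0) => fx; exists f.
Qed.

(** The weak topology refines the initial topology of each functional. *)
Lemma weak_continuous (R : realType) (X : normedModType R) (f : dual X) :
  continuous (f : weak_space X -> R).
Proof.
move=> x.
have nbhs_sub := (@cvg_sup X _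
  (fun g : dual X => Topological.on (initial_topology g))
  (nbhs (x : weak_space X)) x _).1 (@cvg_id _ _) f.
move=> A /(@initial_continuous _ _ f x A).
exact: nbhs_sub.
Qed.

Lemma open_sphere_neq0 (R : realType) (X : normedModType R) (f : dual X) :
  open [set s : set_type (unit_sphere X : set (weak_space X))
       | f (set_val s) != 0].
Proof.
exists [set x : weak_space X | f x != 0] => //.
have /continuousP fO := weak_continuous R X f.
by apply: (fO [set r | r != 0]); exact: open_neq.
Qed.

(* [set_type S] carries the topology induced on the set S. *)
Theorem proposition2p2 (R : realType) (X : completeNormedModType R) :
  lindelof (set_type (unit_sphere X : set (weak_space X))) -> CSP X.
Proof.
set S := set_type _ => lindS F /separates_sphereP sepF.
pose U (f : dual X) : set S := [set s | f (set_val s) != 0].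
have [||G0 [G0F ctG0 G0cover]] := lindS (U @` F).
- by move=> _ [f _ <-]; exact: open_sphere_neq0.
- apply/seteqP; split=> // s _.
  have [f Ff fs] := sepF (set_val s) (set_valP s).
  by exists (U f) => //; exists f.
have /choice[c cP] : forall V : set S, exists f, G0 V -> F f /\ U f = V.
  move=> V; have [/G0F[f Ff fV]|nG0V] := pselect (G0 V); first by exists f.
  (* The zero functional is the default value of c outside G0. *)
  have zero_cont : continuous (\0 : {scalar X}).
    by move=> x; exact: cst_continuous.
  by exists (@Dual R X \0 zero_cont).
exists (c @` G0); split.
- by move=> _ [V /cP[Fc _] <-].
- by apply: sub_countable ctG0; exact: card_image_le.
apply/separates_sphereP => s s1.
pose t : S := exist _ s (mem_set s1).
have [V G0V Vt] : (\bigcup_(V in G0) V) t by rewrite G0cover.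
have [_ UcV] := cP V G0V.
exists (c V); first by exists V.
by suff : U (c V) t by []; rewrite UcV.
Qed.
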